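(* Let $F$ be a finite metric subspace of the unit sphere $\mathbb S^\infty$ in an infinite-dimensional Hilbert space. Let all isometric embeddings of $F$ into $\mathbb S^\infty$ be coloured using finitely many colours. Then for every finite metric subspace $G$ of the sphere $\mathbb S^\infty$ and every $\varepsilon>0$ there is an isometric copy $G'\subset\mathbb S^\infty$ of $G$ such that the set of all isometric embeddings of $F$ into $G'$ is monochromatic up to $\varepsilon$.
   Context: The sphere carries the Euclidean (norm) distance. The set of all isometric embeddings of $F$ into $\mathbb S^\infty$ carries the metric $d_{\sup}(i,j)=\max\{\|i(x)-j(x)\| : x\in F\}$. A colouring with finitely many colours of a metric space $Y$ is a finite partition $\gamma$ of $Y$; a subset $Z\subseteq Y$ is monochromatic up to $\varepsilon$ if $Z$ is contained in the $\varepsilon$-neighbourhood of some $A\in\gamma$. *)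

(* Defs.v *)
From mathcomp Require Import all_boot all_order all_algebra finmap.
From mathcomp Require Import all_classical all_reals all_analysis.
Set Implicit Arguments.
Unset Strict Implicit.
Unset Printing Implicit Defensive.

Import Order.TTheory GRing.Theory Num.Theory.
Import numFieldNormedType.Exports.

Local Open Scope classical_set_scope.
Local Open Scope ring_scope.

(* A real Hilbert space is a complete normed space H together with a positive
   definite symmetric bilinear form inducing the norm.  A complex Hilbert
   space is covered by restriction of scalars (with the real part of its inner
   product): norm, unit sphere, completeness and infinite-dimensionality are
   unchanged. *)
Definition induces_norm (R : realType) (H : normedModType R)
    (dot : {dot H for idfun}) : Prop :=
  forall x : H, dot x x = `|x| ^+ 2.

Definition infinite_dimensional (R : realType) (H : lmodType R) : Prop :=
  ~ exists (n : nat) (e : 'I_n -> H),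
      forall x : H, exists c : 'I_n -> R, x = \sum_(k < n) c k *: e k.

Definition unit_sphere (R : realType) (H : normedModType R) : set H :=
  [set x | `|x| = 1].
Arguments unit_sphere {R} H.

Definition isometric_embeddings (R : realType) (H : normedModType R)
    (F : {fset H}) (X : set H) : set {ffun F -> H} :=
  [set i | (forall x : F, X (i x)) /\
           (forall x y : F, `|i x - i y| = `|val x - val y|)].
Arguments isometric_embeddings {R H} F X.

Definition isometric_copy (R : realType) (H : normedModType R)
    (G G' : {fset H}) : Prop :=
  exists2 g : {ffun G -> H},
    isometric_embeddings G [set` G'] g & range g = [set` G'].

(* The values are nonnegative, so the default 0 only matters for empty F. *)
Definition d_sup (R : realType) (H : normedModType R) (F : {fset H})
    (i j : {ffun F -> H}) : R :=
  \big[Num.max/0]_(x : F) `|i x - j x|.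

Definition finite_colouring (T : Type) (Y : set T) (gamma : set (set T)) :
    Prop :=
  finite_set gamma /\ partition gamma id Y.

Definition eps_neighbourhood (R : realType) (T : Type) (d : T -> T -> R)
    (Y A : set T) (eps : R) : set T :=
  [set y | Y y /\ exists2 a, A a & d y a < eps].

Definition monochromatic_upto (R : realType) (T : Type) (d : T -> T -> R)
    (Y : set T) (gamma : set (set T)) (eps : R) (Z : set T) : Prop :=
  exists2 A, gamma A & Z `<=` eps_neighbourhood d Y A eps.

(* Main.v *)
Require Import Defs.
From mathcomp Require Import all_boot all_order all_algebra finmap.
From mathcomp Require Import all_classical all_reals all_analysis.
From mathcomp Require Import zify ring lra.
Set Implicit Arguments.
Unset Strict Implicit.
Unset Printing Implicit Defensive.

Import Order.TTheory GRing.Theory Num.Theory.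
Import numFieldNormedType.Exports.

(** Isometric embeddings of [F] into the sphere correspond, via coordinates in
    an orthonormal family [e_1, .., e_n] whose span contains [F] and [G], to
    restrictions of linear isometries, and in these coordinates any isometric
    [f : F -> G] has the form [x |-> x *m P] for some orthogonal matrix [P]
    ([gram_orthogonal_extension]).  So it is enough to find, for finitely many
    orthogonal matrices [P_i], a linear isometry [T] of R^n into [H] such that
    all the maps [T \o P_i] are close to isometries of one and the same colour
    ([oscillation_stability]); then [T(G)] is the copy of [G] sought.

    This is extreme amenability of the orthogonal group of [H], usually deduced
    from concentration of the Haar measure on SO(n).  Here concentration is
    only needed on finite product sets.  Take a net [Q_1, .., Q_p] of O(n) with
    the least possible number of points.  Left multiplication by [P] maps it to
    another minimal net, and Hall's marriage theorem pairs the two: there is a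
    permutation [phi] of the indices such that [P *m Q_j] is close to
    [Q_(phi j)] ([almost_invariant_net]).  A word [w] of length [N] over
    [{1, .., p}] gives a linear isometry of R^n into a sum of [N] orthogonal
    copies of R^n, namely [T_w = N^(-1/2) (Q_(w 1), .., Q_(w N))].  Then
    [T_w \o P] is close to [T_(phi w)], and words that differ in few places
    give close isometries, because squared distances are averaged over the [N]
    copies ([amplify_dist]).

    Finally the Hamming distance on words concentrates: if [B] is a set of words of one
    colour whose proportion is at least one over the number of colours, then
    for large [N] almost every word is within [o(N)] of [B]
    ([hamming_concentration]).  As word permutations preserve cardinality, some
    [w] has all its finitely many images [phi_i w] near [B]. *)

(** * Matchings and almost invariant nets *)

Section Marriage.
Variables S T : finType.
Implicit Types (r : S -> T -> bool) (A X : {set S}).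

Definition neighbours r A : {set T} := [set y | [exists x in A, r x y]].

Lemma neighboursP r A y :
  reflect (exists2 x, x \in A & r x y) (y \in neighbours r A).
Proof. by rewrite inE; apply: exists_inP. Qed.

(** Induction on the size of [X].  If some proper nonempty [A] is tight, that
    is, has exactly as many neighbours as elements, match [A] and [X :\: A]
    separately, the latter outside the neighbours of [A]: Hall's condition for
    [A :|: B] gives it for [B].  If no [A] is tight, any edge may be used, since
    removing its end costs each remaining set at most one neighbour.  The
    point [t0] only provides values of [f] off [X]. *)
Lemma hall_marriage (t0 : T) r X :
    (forall A, A \subset X -> (#|A| <= #|neighbours r A|)%N) ->
  exists2 f : S -> T, {in X &, injective f} & {in X, forall x, r x (f x)}.
Proof.
have [n] := ubnP #|X|; elim: n => // n IHn in r X *; rewrite ltnS => leXn hall.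
have [X0|[x0 x0X]] := set_0Vmem X.
  by exists (fun=> t0) => [x y|x]; rewrite X0 inE.
have [[A [A0 AX cA]]|noA] := pselect (exists A,
    [/\ A != finset.set0, A \proper X & #|neighbours r A| = #|A|]).
  have sAX := proper_sub AX; have ltA := proper_card AX.
  have [||f1 inj1 rf1] := IHn r A.
  - exact: leq_trans leXn.
  - by move=> B sBA; apply: hall; apply: fintype.subset_trans sAX.
  pose r' x y := r x y && (y \notin neighbours r A).
  have [||f2 inj2 rf2] := IHn r' (X :\: A).
  - have: (0 < #|A|)%N by rewrite card_gt0.
    rewrite cardsD (finset.setIidPr sAX); lia.
  - move=> B; rewrite finset.subsetD => /andP[sBX dBA].
    have := hall (A :|: B); rewrite finset.subUset sAX sBX => /(_ isT).
    rewrite cardsU disjoint_setI0 1?disjoint_sym // cards0 subn0.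
    have: (#|neighbours r (A :|: B)| <= #|neighbours r A :|: neighbours r' B|)%N.
      apply: subset_leq_card; apply/fintype.subsetP => y /neighboursP[x].
      rewrite !finset.inE => /orP[xA|xB] rxy.
        by apply/orP; left; apply/exists_inP; exists x.
      have [|yA] := boolP (y \in neighbours r A); first by rewrite finset.inE => ->.
      apply/orP; right; apply/exists_inP; exists x => //.
      by rewrite /r' rxy.
    have := (leq_card_setU (neighbours r A) (neighbours r' B)).1.
    lia.
  have xD x : x \in X -> x \notin A -> x \in X :\: A.
    by move=> xX xA; rewrite finset.inE xA.
  have N1 x : x \in A -> f1 x \in neighbours r A.
    by move=> xA; apply/neighboursP; exists x => //; apply: rf1.
  have N2 x : x \in X -> x \notin A -> f2 x \notin neighbours r A.
    by move=> xX xA; have /andP[] := rf2 _ (xD _ xX xA).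
  exists (fun x => if x \in A then f1 x else f2 x) => [x y xX yX|x xX]; last first.
    by case: ifPn => xA; [exact: rf1|have /andP[] := rf2 _ (xD _ xX xA)].
  case: ifPn => xA; case: ifPn => yA.
  - exact: inj1.
  - by move=> e; have := N2 _ yX yA; rewrite -e N1.
  - by move=> e; have := N2 _ xX xA; rewrite e N1.
  - by apply: inj2; apply: xD.
have strict A : A != finset.set0 -> A \proper X -> (#|A| < #|neighbours r A|)%N.
  move=> A0 AX; rewrite ltn_neqAle hall ?proper_sub // andbT eq_sym.
  by apply/eqP => cA; apply: noA; exists A.
have /card_gt0P[y0 /neighboursP[x /finset.set1P-> rxy0]] :
    (0 < #|neighbours r [set x0]|)%N.
  by apply: leq_trans (hall _ _); rewrite ?cards1 // finset.sub1set.
pose r' x y := r x y && (y != y0).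
have X'X : X :\ x0 \proper X by rewrite finset.properD1.
have [||f injf rf] := IHn r' (X :\ x0).
- exact: leq_trans (proper_card X'X) leXn.
- move=> B sBX; have [->|B0] := eqVneq B finset.set0; first by rewrite cards0.
  have := strict B B0 (sub_proper_trans sBX X'X).
  have : neighbours r B \subset y0 |: neighbours r' B.
    apply/fintype.subsetP => y /neighboursP[x' x'B rx'y]; rewrite !finset.inE.
    have [//|yy0] := eqVneq y y0.
    by apply/exists_inP; exists x' => //; rewrite /r' rx'y.
  move/subset_leq_card; rewrite cardsU1; lia.
have xD z : z \in X -> z != x0 -> z \in X :\ x0.
  by move=> zX zx; rewrite !finset.inE zx.
have N z : z \in X -> z != x0 -> f z <> y0.
  by move=> zX zx; have /andP[_ /eqP] := rf _ (xD _ zX zx).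
exists (fun z => if z == x0 then y0 else f z) => [u v uX vX|z zX]; last first.
  by case: eqVneq => [->//|zx]; have /andP[] := rf _ (xD _ zX zx).
case: (eqVneq u x0) => [->|ux]; case: (eqVneq v x0) => [->|vx] //.
- by move=> /esym/N; case.
- by move=> /N; case.
- by apply: injf; apply: xD.
Qed.
End Marriage.

Section Nets.
Variables (X : choiceType) (near : X -> X -> Prop).
Hypothesis near_sym : forall x y, near x y -> near y x.

Definition is_net p (a : 'I_p -> X) := forall x, exists i, near x (a i).

(** One point in each fibre of [q] makes a net; the indices of empty fibres get
    an arbitrary point. *)
Lemma net_of_finite_quotient (K : finType) (q : X -> K) :
  (forall x y, q x = q y -> near x y) -> inhabited X ->
  exists p (a : 'I_p -> X), is_net a.
Proof.
move=> qnear [x0]; exists #|K|.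
exists (fun i => xget x0 [set x | q x = enum_val i]%classic) => x.
exists (enum_rank (q x)); apply: qnear.
by rewrite enum_rankK; case: xgetP => //= /(_ x); case.
Qed.

(** A net with the fewest points is almost permuted by every symmetry [s]: its
    image is again a net, and a violation of Hall's condition for the relation
    of having a common near point would allow a smaller net.  This replaces an
    invariant measure. *)
Lemma minimal_net_matching p0 (a0 : 'I_p0 -> X) : is_net a0 ->
  exists p (a : 'I_p -> X), is_net a /\
    forall s t : X -> X, cancel t s ->
      (forall x y, near x y -> near (s x) (s y)) ->
    exists2 f : 'I_p -> 'I_p, injective f &
      forall i, exists2 x, near (s (a i)) x & near x (a (f i)).
Proof.
move=> neta0.
pose P p := `[< exists a : 'I_p -> X, is_net a >].
have exP : exists p, P p by exists p0; apply/asboolP; exists a0.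
case: (ex_minnP exP) => p /asboolP[a neta] minp.
exists p, a; split=> // s t ts nears.
pose r (i j : 'I_p) := `[< exists2 x, near (s (a i)) x & near x (a j) >].
case: p => [|p] in P exP a neta minp r *.
  by exists id => // -[].
have [|f injf rf] := @hall_marriage _ _ ord0 r finset.setT.
  move=> A _; rewrite leqNgt; apply/negP => ltNA.
  (* the net s o a with its part over A exchanged for a over N(A) *)
  pose B := ~: A; pose N := neighbours r A.
  pose b (k : 'I_(#|B| + #|N|)) := match fintype.split k with
    | inl i => s (a (enum_val i)) | inr j => a (enum_val j) end.
  have : P (#|B| + #|N|)%N.
    apply/asboolP; exists b => x.
    have [i xi] := neta (t x); have {xi} := nears _ _ xi; rewrite ts => xi.
    have [iA|iA] := boolP (i \in A).
      have [j xj] := neta x.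
      have jN : j \in N.
        apply/neighboursP; exists i => //; apply/asboolP.
        by exists x => //; apply: near_sym.
      exists (rshift _ (enum_rank_in jN j)).
      by rewrite /b (unsplitK (inr _)) enum_rankK_in.
    have iB : i \in B by rewrite finset.inE.
    exists (lshift _ (enum_rank_in iB i)).
    by rewrite /b (unsplitK (inl _)) enum_rankK_in.
  have cB : (#|A| + #|B| = p.+1)%N by rewrite cardsC card_ord.
  have ltp : (#|B| + #|N| < p.+1)%N.
    by apply: leq_trans (eq_leq cB); rewrite addnC ltn_add2r.
  by move=> /minp lep; have := leq_trans ltp lep; rewrite ltnn.

exists f => [i j|i]; first by apply: injf; rewrite finset.inE.
by apply/asboolP; apply: rf; rewrite finset.inE.
Qed.
End Nets.

Local Open Scope ring_scope.

(** * Concentration on finite product sets *)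

Section Mean.
Variable R : realFieldType.

Definition mean (T : finType) (f : T -> R) : R := (\sum_x f x) / #|T|%:R.

Lemma mean_cst (T : finType) (c : R) : (0 < #|T|)%N -> mean (fun _ : T => c) = c.
Proof.
move=> T0; rewrite /mean sumr_const -[c *+ _]mulr_natr mulfK //.
by rewrite pnatr_eq0 -lt0n.
Qed.

Lemma ler_mean (T : finType) (f g : T -> R) :
  (forall x, f x <= g x) -> mean f <= mean g.
Proof. by move=> fg; rewrite ler_wpM2r ?invr_ge0 ?ler0n ?ler_sum. Qed.

Lemma meanB (T : finType) (f g : T -> R) :
  mean (fun x => f x - g x) = mean f - mean g.
Proof. by rewrite /mean sumrB mulrBl. Qed.

Lemma meanD (T : finType) (f g : T -> R) :
  mean (fun x => f x + g x) = mean f + mean g.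
Proof. by rewrite /mean big_split mulrDl. Qed.

Lemma meanZ (T : finType) c (f : T -> R) : mean (fun x => c * f x) = c * mean f.
Proof. by rewrite /mean -mulr_sumr mulrA. Qed.

Lemma mean_sqr_dev (T : finType) (f : T -> R) c : (0 < #|T|)%N ->
  mean (fun x => (f x - c) ^+ 2) =
  mean (fun x => f x ^+ 2) - mean f ^+ 2 + (mean f - c) ^+ 2.
Proof.
move=> T0; have -> : (fun x => (f x - c) ^+ 2) =
    (fun x => f x ^+ 2 + - (2 * c) * f x + c ^+ 2).
  by apply/funext => x; ring.
by rewrite !meanD mean_cst // meanZ; ring.
Qed.

(** The uniform measure on words is a product measure. *)
Lemma mean_tupleS (A : finType) N (f : N.+1.-tuple A -> R) :
  mean f = mean (fun a => mean (fun t : N.-tuple A => f [tuple of a :: t])).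
Proof.
rewrite /mean -mulr_suml -mulrA -invfM -natrM; congr (_ / _); last first.
  by rewrite !card_tuple expnSr.
rewrite pair_big /= (reindex (fun u : A * N.-tuple A => [tuple of u.1 :: u.2])) //=.
exists (fun t => (thead t, [tuple of behead t])) => [[a t] _|t _] /=.
  by congr pair; apply/val_inj.
by rewrite [RHS]tuple_eta; apply/val_inj.
Qed.
End Mean.

Section Hamming.
Variable A : finType.
Hypothesis A0 : (0 < #|A|)%N.

Definition hamming N (x y : N.-tuple A) : nat := \sum_(r < N) (tnth x r != tnth y r).

Lemma hammingxx N (x : N.-tuple A) : hamming x x = 0%N.
Proof. by apply: big1 => r _; rewrite eqxx. Qed.

Lemma hamming_triangle N (y x z : N.-tuple A) :
  (hamming x z <= hamming x y + hamming y z)%N.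
Proof.
rewrite /hamming -big_split; apply: leq_sum => r _ /=.
by case: (eqVneq (tnth x r) (tnth y r)) => [->//|_]; case: (_ != _).
Qed.

Lemma hamming_cons N a b (x y : N.-tuple A) :
  hamming [tuple of a :: x] [tuple of b :: y] = ((a != b) + hamming x y)%N.
Proof.
rewrite /hamming big_ord_recl !tnth0; congr addn.
by apply: eq_bigr => r _; rewrite !tnthS.
Qed.

Lemma card_tuple_gt0 N : (0 < #|{: N.-tuple A}|)%N.
Proof. by rewrite card_tuple expn_gt0 A0. Qed.

(** Tensorization of the variance: conditioning on the first letter splits the
    variance into the mean of the conditional variances, at most [N] by
    induction, and the variance of the conditional mean [g], at most 1 because
    the values of [g] are at mutual distance at most 1. *)
Lemma variance_le (R : realFieldType) N (f : N.-tuple A -> R) :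
  (forall x y, f x - f y <= (hamming x y)%:R) ->
  mean (fun x => f x ^+ 2) <= mean f ^+ 2 + N%:R.
Proof.
elim: N f => [|N IHN] f lipf.
  have -> : f = fun=> f [tuple] by apply/funext => x; rewrite [x]tuple0.
  by rewrite !(mean_cst _ (card_tuple_gt0 0)) addr0.
pose g a := mean (fun t : N.-tuple A => f [tuple of a :: t]).
have lipg a b : g a - g b <= 1.
  rewrite -meanB -[leRHS](mean_cst 1 (card_tuple_gt0 N)); apply: ler_mean => t.
  apply: le_trans (lipf _ _) _; rewrite hamming_cons hammingxx addn0.
  by rewrite lern1; case: (_ != _).
have g2 : mean (fun a => g a ^+ 2) <= mean g ^+ 2 + 1.
  have /card_gt0P[b _] := A0.
  have := mean_sqr_dev g (g b) A0.
  have : mean (fun x => (g x - g b) ^+ 2) <= 1.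
    rewrite -[leRHS](mean_cst 1 A0); apply: ler_mean => a.
    by have := lipg a b; have := lipg b a; nra.
  have := sqr_ge0 (mean g - g b); lra.
rewrite mean_tupleS [mean f]mean_tupleS -/g.
apply: (@le_trans _ _ (mean (fun a => g a ^+ 2 + N%:R))).
  apply: ler_mean => a; apply: IHN => x y.
  by apply: le_trans (lipf _ _) _; rewrite hamming_cons eqxx.
by rewrite meanD mean_cst // -natr1; lra.
Qed.

(** The default [N] is the diameter, so that it never affects the minimum over a
    nonempty [B]. *)
Definition hamming_dist N (B : {set N.-tuple A}) x : nat :=
  \big[Order.min/N]_(y in B) hamming x y.

Lemma hamming_dist_le N (B : {set N.-tuple A}) x y :
  y \in B -> (hamming_dist B x <= hamming x y)%N.
Proof.
exact: (@Order.TotalTheory.bigmin_le_cond _ _ _ N y (mem B) (hamming x)).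
Qed.

Lemma hamming_le N (x y : N.-tuple A) : (hamming x y <= N)%N.
Proof.
rewrite -[leqRHS]card_ord -sum1_card; apply: leq_sum => r _.
by case: (_ != _).
Qed.

Lemma hamming_dist_attained N (B : {set N.-tuple A}) x : B != finset.set0 ->
  exists2 y, y \in B & hamming_dist B x = hamming x y.
Proof.
move=> /finset.set0Pn[y0 y0B]; rewrite /hamming_dist.
rewrite (Order.TotalTheory.bigmin_eq_arg _ y0) // => [|y _]; last exact: hamming_le.
by case: Order.TotalTheory.arg_minP => // y yB _; exists y.
Qed.

(** The distance to [B] is 1-Lipschitz, so its variance is at most [N].  It
    vanishes on the large set [B], which forces its squared mean below [c * N];
    Markov's inequality for its square then bounds the number of words far from
    [B]. *)
Lemma hamming_concentration N (B : {set N.-tuple A}) c s :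
  (#|{: N.-tuple A}| <= c * #|B|)%N ->
  (#|[set x | s <= hamming_dist B x]| * s ^ 2 <= c.+1 * N * #|{: N.-tuple A}|)%N.
Proof.
move=> large; have O0 := card_tuple_gt0 N.
have B0 : (0 < #|B|)%N.
  by rewrite lt0n; apply: contraTneq large => ->; rewrite muln0 -ltnNge.
pose f x : rat := (hamming_dist B x)%:R.
have lipf x y : f x - f y <= (hamming x y)%:R.
  have [|z zB yz] := hamming_dist_attained y (B := B); first by rewrite -card_gt0.
  rewrite lerBlDr -natrD ler_nat yz.
  exact: leq_trans (hamming_dist_le _ zB) (hamming_triangle _ _ _).
have var := variance_le lipf.
have sumE (g : N.-tuple A -> rat) : \sum_x g x = mean g * #|{: N.-tuple A}|%:R.
  by rewrite /mean divfK // pnatr_eq0 -lt0n.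
(* f vanishes on B, so the variance alone controls the mean *)
have mean2 : mean f ^+ 2 <= c%:R * N%:R.
  have BR : (0 : rat) < #|B|%:R by rewrite ltr0n.
  rewrite -(ler_pM2r BR).
  have largeR : (#|{: N.-tuple A}|%:R : rat) <= c%:R * #|B|%:R.
    by rewrite -natrM ler_nat.
  have : \sum_(x in B) (f x - mean f) ^+ 2 <= \sum_x (f x - mean f) ^+ 2.
    by rewrite [leRHS](bigID (mem B)) lerDl sumr_ge0 // => x _; apply: sqr_ge0.
  rewrite sumE mean_sqr_dev // subrr expr0n addr0.
  have -> : \sum_(x in B) (f x - mean f) ^+ 2 = mean f ^+ 2 * #|B|%:R.
    rewrite mulr_natr -sumr_const; apply: eq_bigr => x xB.
    have : (hamming_dist B x <= 0)%N by rewrite -(hammingxx x) hamming_dist_le.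
    by rewrite leqn0 /f => /eqP->; rewrite sub0r sqrrN.
  move=> le1; apply: le_trans le1 _.
  apply: (@le_trans _ _ (N%:R * #|{: N.-tuple A}|%:R)).
    by rewrite ler_wpM2r ?ler0n // lerBlDl.
  by rewrite mulrAC [_ * N%:R]mulrC ler_wpM2l ?ler0n.
suff : ((#|[set x | s <= hamming_dist B x]%N| * s ^ 2)%N%:R : rat) <=
    (c.+1 * N * #|{: N.-tuple A}|)%N%:R by rewrite ler_nat.
apply: (@le_trans _ _ (\sum_x f x ^+ 2)).
  rewrite natrM mulrC mulr_natr -sumr_const big_mkcond /=; apply: ler_sum => x _.
  rewrite finset.inE; case: ifP => [sx|_]; last exact: sqr_ge0.
  by rewrite /f -natrX ler_nat leq_exp2r.
rewrite sumE natrM ler_wpM2r ?ler0n // natrM -natr1 mulrDl mul1r.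
by apply: le_trans var _; rewrite lerD2r.
Qed.
End Hamming.

(** * The orthogonal group *)

(** The variance is nonnegative. *)
Lemma sqr_sum_le (R : realFieldType) (T : finType) (f : T -> R) :
  (\sum_x f x) ^+ 2 <= #|T|%:R * \sum_x f x ^+ 2.
Proof.
have [T0|T0] := posnP #|T|.
  by rewrite !big_pred0 ?expr0n ?mulr0 // => x; apply/negP => _;
    have := fintype0 x T0.
have := mean_sqr_dev f (mean f) T0; rewrite subrr expr0n addr0.
have : 0 <= mean (fun x => (f x - mean f) ^+ 2).
  by rewrite divr_ge0 ?ler0n ?sumr_ge0 // => x _; apply: sqr_ge0.
have TR : (0 : R) < #|T|%:R by rewrite ltr0n.
have E (g : T -> R) : \sum_x g x = mean g * #|T|%:R.
  by rewrite /mean divfK // gt_eqF.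
rewrite !E => h1 h2.
rewrite exprMn mulrC expr2 -mulrA !ler_pM2l // mulrC ler_pM2r //; lra.
Qed.

Section Euclidean.
Variables (R : realType) (n : nat).
Implicit Types (u v w x : 'rV[R]_n) (P Q : 'M[R]_n).

Definition dotv u v : R := (u *m v^T) 0 0.
Definition sqnorm u : R := dotv u u.

Lemma dotvE u v : dotv u v = \sum_j u 0 j * v 0 j.
Proof. by rewrite /dotv mxE; apply: eq_bigr => j _; rewrite mxE. Qed.

Lemma dotvC u v : dotv u v = dotv v u.
Proof. by rewrite !dotvE; apply: eq_bigr => j _; rewrite mulrC. Qed.

Lemma dotvBl u v w : dotv (u - v) w = dotv u w - dotv v w.
Proof. by rewrite /dotv mulmxBl !mxE. Qed.

Lemma dotvZl a u w : dotv (a *: u) w = a * dotv u w.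
Proof. by rewrite /dotv -scalemxAl mxE. Qed.

Lemma dotvBr u v w : dotv w (u - v) = dotv w u - dotv w v.
Proof. by rewrite dotvC dotvBl !(dotvC w). Qed.

Lemma dotvZr a u w : dotv w (a *: u) = a * dotv w u.
Proof. by rewrite dotvC dotvZl (dotvC w). Qed.

Lemma sqnormE u : sqnorm u = \sum_j u 0 j ^+ 2.
Proof. by rewrite /sqnorm dotvE; apply: eq_bigr => j _; rewrite expr2. Qed.

Lemma sqnorm_ge0 u : 0 <= sqnorm u.
Proof. by rewrite sqnormE sumr_ge0 // => j _; apply: sqr_ge0. Qed.

Lemma sqnorm_eq0 u : (sqnorm u == 0) = (u == 0).
Proof.
apply/eqP/eqP => [|->]; last by rewrite /sqnorm /dotv mul0mx mxE.
rewrite sqnormE => /psumr_eq0P u0; apply/rowP => j; rewrite mxE.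
by apply/eqP; rewrite -sqrf_eq0 u0 // => i _; apply: sqr_ge0.
Qed.

Lemma sqnormB u v : sqnorm (u - v) = sqnorm u + sqnorm v - 2 * dotv u v.
Proof. by rewrite /sqnorm !dotvBl !dotvBr (dotvC v u); ring. Qed.

Lemma sqnormN u : sqnorm (- u) = sqnorm u.
Proof. by rewrite -scaleN1r /sqnorm dotvZl dotvZr; ring. Qed.

Lemma sqnorm_triangle v u w :
  sqnorm (u - w) <= 2 * sqnorm (u - v) + 2 * sqnorm (v - w).
Proof.
rewrite !sqnormE !mulr_sumr -big_split; apply: ler_sum => j _.
by rewrite !mxE /=; have := sqr_ge0 ((u 0 j - v 0 j) - (v 0 j - w 0 j)); nra.
Qed.

Definition orthogonal_mx Q := Q *m Q^T == 1%:M.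

Lemma orthogonal_mxP Q : orthogonal_mx Q -> forall u v,
  dotv (u *m Q) (v *m Q) = dotv u v.
Proof.
by move=> /eqP oQ u v; rewrite /dotv trmx_mul !mulmxA -(mulmxA u) oQ mulmx1.
Qed.

Lemma sqnorm_orthogonal Q u : orthogonal_mx Q -> sqnorm (u *m Q) = sqnorm u.
Proof. by move=> /orthogonal_mxP; apply. Qed.

Lemma orthogonal_mx1 : orthogonal_mx 1%:M.
Proof. by rewrite /orthogonal_mx trmx1 mulmx1. Qed.

Lemma orthogonal_mxM P Q :
  orthogonal_mx P -> orthogonal_mx Q -> orthogonal_mx (P *m Q).
Proof.
move=> /eqP oP /eqP oQ.
by rewrite /orthogonal_mx trmx_mul mulmxA -(mulmxA P) oQ mulmx1 oP.
Qed.

Lemma orthogonal_mx_tr Q : orthogonal_mx Q -> orthogonal_mx Q^T.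
Proof. by move=> /eqP/mulmx1C oQ; rewrite /orthogonal_mx trmxK oQ. Qed.

Lemma orthogonal_mx_entry Q i j : orthogonal_mx Q -> -1 <= Q i j <= 1.
Proof.
move=> /eqP oQ; have : (Q *m Q^T) i i = 1 by rewrite oQ mxE eqxx.
rewrite mxE (bigD1 j) //= mxE => e.
have : 0 <= \sum_(k | k != j) Q i k * Q^T k i.
  by apply: sumr_ge0 => k _; rewrite mxE -expr2 sqr_ge0.
by move=> h; apply/andP; split; nra.
Qed.

(** For [u != v] the reflection in the hyperplane orthogonal to [u - v]
    exchanges [u] and [v], as they have the same norm, and it fixes the vectors having the
    same scalar product with [u] and [v]. *)
Lemma reflection_mx u v : sqnorm u = sqnorm v ->
  exists Q, [/\ orthogonal_mx Q, u *m Q = v &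
    forall x, dotv x u = dotv x v -> x *m Q = x].
Proof.
move=> uv; have [->|uDv] := eqVneq u v.
  by exists 1%:M; split=> [||x _]; rewrite ?mulmx1 // orthogonal_mx1.
pose w := u - v; have w0 : sqnorm w != 0 by rewrite sqnorm_eq0 subr_eq0.
pose Q : 'M[R]_n := 1%:M - (2 / sqnorm w) *: (w^T *m w).
have QE x : x *m Q = x - (2 * dotv x w / sqnorm w) *: w.
  rewrite /Q mulmxBr mulmx1 -scalemxAr mulmxA; congr (_ - _).
  have -> : x *m w^T = (dotv x w)%:M.
    by rewrite [x *m w^T]mx11_scalar.
  by rewrite mul_scalar_mx scalerA mulrAC.
have dQ x y : dotv (x *m Q) (y *m Q) = dotv x y.
  rewrite !QE; move: (w) w0 => z z0.
  rewrite !dotvBl !dotvBr !dotvZl !dotvZr (dotvC z y) -/(sqnorm z).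
  by field.
exists Q; split.
- apply/eqP/matrixP => i j.
  have := dQ (delta_mx 0 i) (delta_mx 0 j).
  rewrite /dotv trmx_mul !mulmxA -(mulmxA (delta_mx 0 i)) trmx_delta.
  rewrite -!colE ![col _ _ _ _]mxE -!rowE ![row _ _ _ _]mxE => ->.
  by rewrite !mxE eqxx eq_sym.
- have wE : sqnorm w = 2 * dotv u w.
    by rewrite sqnormB dotvBr -/(sqnorm u) -uv; ring.
  by rewrite QE -wE divff // scale1r /w opprB addrC subrK.
- by move=> x xuv; rewrite QE dotvBr xuv subrr mulr0 mul0r scale0r subr0.
Qed.

(** Move the vectors to their targets one at a time, each by a reflection: by
    equality of the Gram matrices it fixes the targets already reached. *)
Lemma gram_orthogonal_extension (I : eqType) (s : seq I) (u v : I -> 'rV[R]_n) :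
  (forall i j, dotv (u i) (u j) = dotv (v i) (v j)) ->
  exists2 Q, orthogonal_mx Q & {in s, forall i, u i *m Q = v i}.
Proof.
move=> gram; elim: s => [|k s [Q oQ uQ]].
  by exists 1%:M => //; apply: orthogonal_mx1.
have [|P [oP kP fixP]] := @reflection_mx (u k *m Q) (v k).
  by rewrite sqnorm_orthogonal // /sqnorm gram.
exists (Q *m P) => [|i]; first exact: orthogonal_mxM.
rewrite inE mulmxA => /predU1P[->//|si]; rewrite uQ // fixP //.
by rewrite -gram -(uQ i si) orthogonal_mxP.
Qed.

(** [eta] bounds the square of the operator norm, which avoids square roots
    throughout. *)
Definition near_mx (eta : R) P Q :=
  forall v, sqnorm (v *m P - v *m Q) <= eta * sqnorm v.

Lemma near_mx_entries eta d P Q : (forall i j, `|P i j - Q i j| <= d) ->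
  n%:R ^+ 2 * d ^+ 2 <= eta -> near_mx eta P Q.
Proof.
move=> PQ le v; apply: le_trans (ler_wpM2r (sqnorm_ge0 v) le).
rewrite -mulmxBr sqnormE.
have -> : n%:R ^+ 2 * d ^+ 2 * sqnorm v = \sum_(j < n) n%:R * (d ^+ 2 * sqnorm v).
  by rewrite sumr_const card_ord -[RHS]mulr_natl; ring.
apply: ler_sum => j _; rewrite mxE; apply: le_trans (sqr_sum_le _) _.
rewrite card_ord ler_wpM2l ?ler0n // sqnormE mulr_sumr; apply: ler_sum => i _.
rewrite exprMn [leRHS]mulrC ler_wpM2l ?sqr_ge0 // !mxE.
by rewrite -[leLHS]real_normK ?num_real // lerXn2r ?nnegrE ?(le_trans _ (PQ i j)).
Qed.
End Euclidean.

Section OrthogonalNet.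
Variables (R : realType) (n : nat).
Let ortho_type := {Q : 'M[R]_n | orthogonal_mx Q}.

(** Total boundedness of the orthogonal group: its entries lie in [[-1, 1]], and
    rounding them to multiples of [1 / M] leaves finitely many classes. *)
Lemma orthogonal_net (eta : R) : 0 < eta ->
  exists p (a : 'I_p -> ortho_type),
    is_net (fun P Q : ortho_type => near_mx eta (val P) (val Q)) a.
Proof.
move=> eta0; pose M := (Num.truncn (n%:R ^+ 2 / eta)).+1.
have MR : (0 : R) < M%:R by rewrite ltr0n.
have le : n%:R ^+ 2 * (M%:R^-1) ^+ 2 <= eta.
  rewrite exprVn ler_pdivrMr ?exprn_gt0 //.
  have : n%:R ^+ 2 / eta < M%:R by apply: truncnS_gt.
  rewrite ltr_pdivrMr // => lt; apply: le_trans (ltW lt) _.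
  have M1 : (1 : R) <= M%:R by rewrite ler1n.
  by nra.
pose cell (x : R) := Num.truncn ((x + 1) * M%:R).
have cell_lt x : -1 <= x <= 1 -> (cell x < (2 * M).+1)%N.
  move=> /andP[x1 x2]; rewrite -(ltr_nat R).
  apply: (@le_lt_trans _ _ ((x + 1) * M%:R)).
    by rewrite truncn_le // mulr_ge0 ?ler0n //; lra.
  rewrite -natr1 natrM; nra.
have cell_near x y : -1 <= x <= 1 -> -1 <= y <= 1 -> cell x = cell y ->
    `|x - y| <= M%:R^-1.
  move=> /andP[x1 x2] /andP[y1 y2] xy.
  have /truncn_itv : 0 <= (x + 1) * M%:R by rewrite mulr_ge0 ?ler0n //; lra.
  have /truncn_itv : 0 <= (y + 1) * M%:R by rewrite mulr_ge0 ?ler0n //; lra.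
  rewrite -!/(cell _) xy -natr1 => /andP[a1 a2] /andP[b1 b2].
  rewrite -[leRHS]mul1r ler_pdivlMr // -[X in _ * X]gtr0_norm // -normrM.
  by rewrite ler_norml; apply/andP; split; lra.
pose q (P : ortho_type) : {ffun 'I_n * 'I_n -> 'I_(2 * M).+1} :=
  [ffun k => inord (cell (val P k.1 k.2))].
apply: (net_of_finite_quotient (q := q)); last first.
  by constructor; exists 1%:M; apply: orthogonal_mx1.
move=> P Q PQ; apply: near_mx_entries le => i j.
have bP := orthogonal_mx_entry i j (valP P).
have bQ := orthogonal_mx_entry i j (valP Q).
apply: cell_near => //.
have /(congr1 val) := congr1 (fun f : {ffun _} => f (i, j)) PQ.
by rewrite !ffunE /= !inordK ?cell_lt.
Qed.

(** Left multiplication by an orthogonal matrix preserves nearness and is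
    invertible.  The triangle inequality for squared norms applied to two
    [eta / 4] steps gives [eta]. *)
Lemma almost_invariant_net (eta : R) : 0 < eta ->
  exists p (a : 'I_p.+1 -> 'M[R]_n), (forall i, orthogonal_mx (a i)) /\
    forall P, orthogonal_mx P -> exists2 f : 'I_p.+1 -> 'I_p.+1, injective f &
      forall i, near_mx eta (P *m a i) (a (f i)).
Proof.
move=> eta0; have eta4 : 0 < eta / 4 by lra.
have [p0 [a0 neta0]] := orthogonal_net eta4.
have [|p [a [neta mat]]] := minimal_net_matching _ neta0.
  by move=> P Q PQ v; rewrite -sqnormN opprB.
case: p a neta mat => [|p] a neta mat.
  by have [[]] := neta (exist _ 1%:M (orthogonal_mx1 R n)).
exists p, (fun i => val (a i)); split=> [i|P oP]; first exact: valP.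
pose mul (P Q : ortho_type) : ortho_type :=
  exist _ (val P *m val Q) (orthogonal_mxM (valP P) (valP Q)).
pose sP : ortho_type := exist _ P oP.
pose tP : ortho_type := exist _ P^T (orthogonal_mx_tr oP).
have [||f injf nf] := mat (mul sP) (mul tP).
- by move=> Q; apply: val_inj; rewrite /= mulmxA (eqP oP) mul1mx.
- by move=> Q Q' nQ v; rewrite /= !mulmxA -(sqnorm_orthogonal v oP); apply: nQ.
exists f => // i v; have [Q h1 h2] := nf i.
have := sqnorm_triangle (v *m val Q) (v *m (P *m val (a i))) (v *m val (a (f i))).
by have := h1 v; have := h2 v; rewrite /=; lra.
Qed.
End OrthogonalNet.

(** * Isometries into an infinite-dimensional space *)

Section Hilbert.
Variables (R : realType) (H : normedModType R) (dot : {dot H for idfun}).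
Hypothesis dot_norm : forall x : H, dot x x = `|x| ^+ 2.
Implicit Types (x y z : H).

Lemma dotC x y : dot x y = dot y x.
Proof. by rewrite hermC expr0 mul1r. Qed.

Lemma dotZl a x z : dot (a *: x) z = a * dot x z.
Proof. exact: linearZl_LR. Qed.

Lemma dotBl x y z : dot (x - y) z = dot x z - dot y z.
Proof. exact: linearBl. Qed.

Lemma dot_suml (I : finType) (f : I -> H) z :
  dot (\sum_i f i) z = \sum_i dot (f i) z.
Proof. exact: linear_sumlz. Qed.

Lemma normB_sqr x y : `|x - y| ^+ 2 = `|x| ^+ 2 + `|y| ^+ 2 - 2 * dot x y.
Proof.
rewrite -!dot_norm dotBl (dotC x (x - y)) (dotC y (x - y)) !dotBl (dotC y x).
by ring.
Qed.

Definition ortho_family (I : finType) (e : I -> H) :=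
  forall i j, dot (e i) (e j) = (i == j)%:R.

Lemma dot_comb (I : finType) (e : I -> H) (c d : I -> R) : ortho_family e ->
  dot (\sum_i c i *: e i) (\sum_i d i *: e i) = \sum_i c i * d i.
Proof.
move=> oe; rewrite dot_suml; apply: eq_bigr => i _.
rewrite dotZl dotC dot_suml (bigD1 i) //= big1 ?addr0 => [|j ji].
  by rewrite dotZl oe eqxx mulr1.
by rewrite dotZl oe (negPf ji) mulr0.
Qed.

Definition proj n (e : 'I_n -> H) x := \sum_i dot x (e i) *: e i.

Lemma dot_proj n (e : 'I_n -> H) x i : ortho_family e ->
  dot (proj e x) (e i) = dot x (e i).
Proof.
move=> oe; rewrite /proj dot_suml (bigD1 i) //= big1 ?addr0 => [|j ji].
  by rewrite dotZl oe eqxx mulr1.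
by rewrite dotZl oe (negPf ji) mulr0.
Qed.

(** Adjoin the normalized component of [x] orthogonal to the family. *)
Lemma gram_schmidt_step n (e : 'I_n -> H) x : ortho_family e -> proj e x != x ->
  exists f : 'I_n.+1 -> H, [/\ ortho_family f, proj f x = x &
    forall y, proj e y = y -> proj f y = y].
Proof.
move=> oe xe; pose z := x - proj e x.
have z0 : z != 0 by rewrite subr_eq0 eq_sym.
have nz : `|z| != 0 by rewrite normr_eq0.
have ze i : dot z (e i) = 0 by rewrite dotBl dot_proj // subrr.
pose u := `|z|^-1 *: z.
have ue i : dot u (e i) = 0 by rewrite dotZl ze mulr0.
have uu : dot u u = 1.
  by rewrite dotZl dotC dotZl dot_norm; field.
pose f (i : 'I_n.+1) := if unlift ord0 i is Some j then e j else u.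
have f0 : f ord0 = u by rewrite /f unlift_none.
have fS j : f (lift ord0 j) = e j by rewrite /f liftK.
have projf y : proj f y = dot y u *: u + proj e y.
  rewrite /proj big_ord_recl f0; congr (_ + _).
  by apply: eq_bigr => j _; rewrite fS.
exists f; split.
- move=> i j.
  case: (unliftP ord0 i) => [i'|] ->; case: (unliftP ord0 j) => [j'|] ->.
  + by rewrite !fS oe (inj_eq (lift_inj)).
  + by rewrite fS f0 dotC ue eq_sym (negPf (neq_lift _ _)).
  + by rewrite fS f0 ue (negPf (neq_lift _ _)).
  + by rewrite f0 uu eqxx.
- have xu : dot x u = `|z|.
    have : dot z u = dot x u.
      rewrite dotBl /proj dot_suml big1 ?subr0 // => i _.
      by rewrite dotZl (dotC (e i)) ue mulr0.
    by move=> <-; rewrite dotC dotZl dot_norm; field.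
  by rewrite projf xu scalerA divff // scale1r subrK.
- move=> y ye; rewrite projf ye -[in dot y u]ye /proj dot_suml.
  rewrite big1 ?scale0r ?add0r // => i _.
  by rewrite dotZl (dotC (e i)) ue mulr0.
Qed.

Lemma gram_schmidt (s : seq H) :
  exists n (e : 'I_n -> H), ortho_family e /\ {in s, forall x, proj e x = x}.
Proof.
elim: s => [|x s [n [e [oe se]]]].
  by exists 0%N, (fun=> 0); split=> // -[].
have [xe|xe] := eqVneq (proj e x) x.
  by exists n, e; split=> // y; rewrite inE => /predU1P[->|/se].
have [f [of_ xf ef]] := gram_schmidt_step oe xe.
by exists n.+1, f; split=> // y; rewrite inE => /predU1P[->|/se/ef].
Qed.

(** A finite orthonormal family does not span [H], so it can be extended. *)
Lemma ortho_family_exists (I : finType) : infinite_dimensional H ->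
  exists e : I -> H, ortho_family e.
Proof.
move=> infH; suff [e oe] : exists e : 'I_#|I| -> H, ortho_family e.
  exists (fun i => e (enum_rank i)) => i j.
  by rewrite oe (inj_eq enum_rank_inj).
elim: #|I| => [|n [e oe]]; first by exists (fun=> 0) => -[].
have [x xe] : exists x, proj e x != x.
  apply: contrapT => /forallNP spanH; apply: infH; exists n, e => x.
  exists (fun i => dot x (e i)); apply/esym/eqP.
  by apply: contraPT (spanH x) => h; apply.
by have [f [of_ _ _]] := gram_schmidt_step oe xe; exists f.
Qed.

Section Amplification.
Variables (N n : nat) (e : 'I_N * 'I_n -> H).
Hypothesis oe : ortho_family e.
Implicit Types (Q : 'I_N -> 'M[R]_n) (v : 'rV[R]_n).

(** The diagonal map [v |-> N^(-1/2) (v *m Q_1, .., v *m Q_N)] into the sum of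
    [N] copies of R^n, where [e (r, j)] is the [j]-th basis vector of the [r]-th
    copy. *)
Definition amplify Q v : H :=
  (Num.sqrt N%:R)^-1 *: \sum_k (v *m Q k.1) 0 k.2 *: e k.

(** Pythagoras.  The average over the copies is what makes a change of few [Q r]
    negligible. *)
Lemma amplify_dist Q Q' u v : `|amplify Q u - amplify Q' v| ^+ 2 =
  N%:R^-1 * \sum_r sqnorm (u *m Q r - v *m Q' r).
Proof.
rewrite /amplify -scalerBr -sumrB normrZ exprMn.
congr (_ * _).
  by rewrite real_normK ?num_real // exprVn sqr_sqrtr ?ler0n.
under eq_bigr do rewrite -scalerBl.
rewrite -dot_norm dot_comb //.
rewrite -(pair_bigA _ (fun r j => ((u *m Q r) 0 j - (v *m Q' r) 0 j) *
   ((u *m Q r) 0 j - (v *m Q' r) 0 j))) /=.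
apply: eq_bigr => r _; rewrite sqnormE; apply: eq_bigr => j _.
by rewrite !mxE expr2.
Qed.
End Amplification.

Definition linear_isometry n (T : 'rV[R]_n -> H) :=
  (forall u, `|T u| ^+ 2 = sqnorm u) /\
  (forall u v, `|T u - T v| ^+ 2 = sqnorm (u - v)).

Lemma amplify_isometry N n (e : 'I_N * 'I_n -> H) Q :
  (0 < N)%N -> ortho_family e -> (forall r, orthogonal_mx (Q r)) ->
  linear_isometry (amplify e Q).
Proof.
move=> N0 oe oQ; have NR : (N%:R : R) != 0 by rewrite pnatr_eq0 -lt0n.
have dist u v : `|amplify e Q u - amplify e Q v| ^+ 2 = sqnorm (u - v).
  rewrite amplify_dist //.
  under eq_bigr do rewrite -mulmxBl sqnorm_orthogonal //.
  by rewrite sumr_const card_ord -[sqnorm _ *+ _]mulr_natl mulKf.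
split=> // u; rewrite -[u in RHS]subr0 -dist; congr (`|_| ^+ 2).
rewrite /amplify [X in _ - _ *: X]big1 ?scaler0 ?subr0 // => k _.
by rewrite mul0mx mxE scale0r.
Qed.

Lemma pigeonhole (T K : finType) (f : T -> K) : (0 < #|T|)%N ->
  exists k, (#|T| <= #|K| * #|[set x | f x == k]%SET|)%N.
Proof.
move=> /card_gt0P[x0 _].
pose k := [arg max_(k > f x0) #|[set x | f x == k]%SET|].
exists k; rewrite -[leqLHS]sum1_card [leqLHS](partition_big f xpredT) //=.
rewrite -sum_nat_const.
rewrite [leqRHS](eq_bigl xpredT) //; apply: leq_sum => i _; rewrite sum1dep_card.
by rewrite /k; case: arg_maxnP => // j _; apply.
Qed.

(** Extreme amenability of the orthogonal group of [H] in finitary form; the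
    argument is explained at the top. *)
Theorem oscillation_stability n (I K : finType) (P : I -> 'M[R]_n)
    (col : ('rV[R]_n -> H) -> K) (eps : R) :
  infinite_dimensional H -> (forall i, orthogonal_mx (P i)) -> 0 < eps ->
  exists T k, linear_isometry T /\ forall i, exists T',
    [/\ linear_isometry T', col T' = k &
      forall v, `|T (v *m P i) - T' v| ^+ 2 <= eps * sqnorm v].
Proof.
move=> infH oP eps0.
have eta0 : 0 < eps / 4 by lra.
have [p [a [oa inva]]] := almost_invariant_net n eta0.
have /choice[phi phiP] i : exists f : 'I_p.+1 -> 'I_p.+1, injective f /\
    forall j, near_mx (eps / 4) (P i *m a j) (a (f j)).
  by have [f injf nf] := inva _ (oP i); exists f.
(* s letters out of N = D * s may change at a cost of eps / 2; since N is
   linear in s, the bound s ^ 2 of the concentration inequality beats the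
   union bound over I for this s *)
pose D := (Num.truncn (16 / eps)).+1.
have DE : 16 <= eps * D%:R.
  have : 16 / eps < D%:R by apply: truncnS_gt.
  by rewrite ltr_pdivrMr // mulrC => /ltW.
pose s := (#|I| * (#|K|.+1 * D)).+1; pose N := (D * s)%N.
have N0 : (0 < N)%N by [].
have [e oe] := ortho_family_exists ('I_N * 'I_n)%type infH.
pose T (w : N.-tuple 'I_p.+1) := amplify e (fun r => a (tnth w r)).
have isoT w : linear_isometry (T w) by apply: amplify_isometry.
have A0 : (0 < #|'I_p.+1|)%N by rewrite card_ord.
have O0 := card_tuple_gt0 A0 N.
have [k Bk] := pigeonhole (fun w => col (T w)) O0.
set B := [set w | col (T w) == k]%SET in Bk.
have conc := hamming_concentration A0 s Bk.
set far := [set x | _]%SET in conc.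
pose bad i := [set w | map_tuple (phi i) w \in far]%SET.
have cbad i : (#|bad i| <= #|far|)%N.
  rewrite -(@card_preimset _ (map_tuple (phi i)) far); last first.
    move=> w w' /(congr1 val) /= /inj_map ww'.
    by apply: val_inj; apply: ww'; have [] := phiP i.
  by apply: subset_leq_card; apply/fintype.subsetP => w; rewrite !finset.inE.
(* union bound: each bad set is the preimage of far under a permutation *)
have [w wgood] : exists w, forall i, w \notin bad i.
  apply: contrapT => nogood.
  have : (#|{: N.-tuple 'I_p.+1}| <= #|I| * #|far|)%N.
    rewrite -[leqLHS]cardsT -sum_nat_const.
    apply: (@leq_trans (\sum_(i in I) #|bad i|)%N); last by apply: leq_sum.
    rewrite [leqRHS](eq_bigl xpredT) //.
    apply: (@leq_trans #|\bigcup_i bad i|%SET).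
      apply: subset_leq_card; apply/fintype.subsetP => w _.
      apply: contrapT => wgood; apply: nogood; exists w => i.
      by apply/negP => wi; apply: wgood; apply/finset.bigcupP; exists i.
    elim/big_rec2: _ => [|i m S _ le]; first by rewrite cards0.
    apply: leq_trans (leq_card_setU _ _).1 _; rewrite leq_add2l //.
  move=> le.
  have : (#|{: N.-tuple 'I_p.+1}| * s ^ 2 <=
          #|I| * (#|K|.+1 * N) * #|{: N.-tuple 'I_p.+1}|)%N.
    apply: (@leq_trans (#|I| * #|far| * s ^ 2)); first by rewrite leq_mul2r le orbT.
    by have := leq_mul (leqnn #|I|) conc; rewrite !mulnA.
  rewrite mulnC leq_pmul2r // /N !mulnA -mulnn leq_pmul2r // -!mulnA.
  by rewrite ltnn.
have B0 : B != finset.set0.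
  rewrite -card_gt0 lt0n; apply: contraTneq Bk => ->.
  by rewrite muln0 -ltnNge.
exists (T w), k; split=> // i.
have [w' w'B dw'] := hamming_dist_attained (map_tuple (phi i) w) B0.
exists (T w'); split=> //; first by move: w'B; rewrite finset.inE => /eqP.
move=> v; rewrite amplify_dist //.
have dlt : (hamming (map_tuple (phi i) w) w' < s)%N.
  by have := wgood i; rewrite !finset.inE dw' ltnNge.
have NR : (0 : R) < N%:R by rewrite ltr0n.
rewrite ler_pdivrMl //.
(* in each copy: two nearby matrices if the letters agree, otherwise any two
   orthogonal ones *)
apply: (@le_trans _ _ (\sum_(r < N) (eps / 2 * sqnorm v +
    8 * sqnorm v * (tnth (map_tuple (phi i) w) r != tnth w' r)%:R))).
  apply: ler_sum => r _.
  have [_ nP] := phiP i.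
  apply: le_trans (sqnorm_triangle (v *m a (phi i (tnth w r))) _ _) _.
  have := nP (tnth w r) v; rewrite mulmxA => n1.
  rewrite tnth_map; have [<-|_] := eqVneq (phi i (tnth w r)) (tnth w' r).
    rewrite subrr (eqP (_ : sqnorm 0 == 0)) ?sqnorm_eq0 // !mulr0; lra.
  have := sqnorm_triangle 0 (v *m a (phi i (tnth w r))) (v *m a (tnth w' r)).
  rewrite subr0 sub0r sqnormN !sqnorm_orthogonal //= mulr1; lra.
rewrite big_split /= sumr_const card_ord -mulr_sumr -natr_sum.
rewrite -[(_ * _) *+ _]mulr_natl.
rewrite -/(hamming _ _).
have dR : (hamming (map_tuple (phi i) w) w')%:R <= (s%:R : R).
  by rewrite ler_nat ltnW.
have NE : (N%:R : R) = D%:R * s%:R by rewrite natrM.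
have v0 := sqnorm_ge0 v.
have s0 : (0 : R) <= s%:R by rewrite ler0n.
have h : 8 * (hamming (map_tuple (phi i) w) w')%:R <= eps / 2 * N%:R.
  rewrite NE; nra.
nra.
Qed.
End Hilbert.

(** * Monochromatic copies *)

Local Open Scope classical_set_scope.

Lemma normr_sqr_inj (R : realType) (H : normedModType R) (x y : H) :
  `|x| ^+ 2 = `|y| ^+ 2 -> `|x| = `|y|.
Proof. by move=> /eqP; rewrite eqrXn2 // => /eqP. Qed.

Theorem corollary6p13 (R : realType) (H : completeNormedModType R)
    (dot : {dot H for idfun}) (hdot : induces_norm dot)
    (hinf : infinite_dimensional H)
    (F : {fset H}) (hF : [set` F] `<=` unit_sphere H)
    (gamma : set (set {ffun F -> H}))
    (hgamma : finite_colouring (isometric_embeddings F (unit_sphere H)) gamma)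
    (G : {fset H}) (hG : [set` G] `<=` unit_sphere H)
    (eps : R) (heps : 0 < eps) :
  exists G' : {fset H},
    [/\ [set` G'] `<=` unit_sphere H,
        isometric_copy G G' &
        monochromatic_upto (@d_sup R H F)
          (isometric_embeddings F (unit_sphere H)) gamma eps
          (isometric_embeddings F [set` G'])].
Proof.
have [n [e [oe spanFG]]] := gram_schmidt hdot (enum_fset F ++ enum_fset G).
pose c (x : H) : 'rV[R]_n := \row_j dot x (e j).
have spanF (x : F) : proj dot e (val x) = val x.
  by apply: spanFG; rewrite mem_cat (valP x).
have spanG (x : G) : proj dot e (val x) = val x.
  by apply: spanFG; rewrite mem_cat (valP x) orbT.
have dotc x y : proj dot e x = x -> proj dot e y = y -> dotv (c x) (c y) = dot x y.
  move=> xe ye; rewrite -[in RHS]xe -[in RHS]ye dot_comb // dotvE.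
  by apply: eq_bigr => j _; rewrite !mxE.
have normF (x : F) : `|val x| = 1 by apply: hF; exact: (valP x).
have normG (x : G) : `|val x| = 1 by apply: hG; exact: (valP x).
have sqF (x : F) : sqnorm (c (val x)) = 1.
  by rewrite /sqnorm dotc // hdot normF expr1n.
have sqG (x : G) : sqnorm (c (val x)) = 1.
  by rewrite /sqnorm dotc // hdot normG expr1n.
have distF (x y : F) : sqnorm (c (val x) - c (val y)) = `|val x - val y| ^+ 2.
  by rewrite sqnormB !sqF dotc // (normB_sqr hdot) !normF !expr1n.
have distG (x y : G) : sqnorm (c (val x) - c (val y)) = `|val x - val y| ^+ 2.
  by rewrite sqnormB !sqG dotc // (normB_sqr hdot) !normG !expr1n.
(* [c] turns both sets into points of R^n with the same Gram matrices *)
pose isom (f : {ffun F -> G}) :=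
  forall x y : F, `|val (f x) - val (f y)| = `|val x - val y|.
have /choice[P oP] (f : {ffun F -> G}) : exists Q : 'M[R]_n, orthogonal_mx Q /\
    (isom f -> forall x, c (val x) *m Q = c (val (f x))).
  have [isof|niso] := pselect (isom f); last first.
    by exists 1%:M; split=> //; apply: orthogonal_mx1.
  have [x y|Q oQ uQ] := gram_orthogonal_extension (enum (predT : pred F))
      (u := fun x => c (val x)) (v := fun x => c (val (f x))).
    have := sqnormB (c (val (f x))) (c (val (f y))).
    have := sqnormB (c (val x)) (c (val y)).
    rewrite distF distG isof !sqF !sqG; lra.
  by exists Q; split=> // _ x; apply: uQ; rewrite mem_enum.
pose emb (T : 'rV[R]_n -> H) : {ffun F -> H} := [ffun x => T (c (val x))].
have embP T : linear_isometry T -> isometric_embeddings F (unit_sphere H) (emb T).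
  move=> [T1 T2]; split=> [x|x y]; rewrite !ffunE.
    by apply/eqP; rewrite -(eqrXn2 (n := 2)) // expr1n T1 sqF.
  by apply: normr_sqr_inj; rewrite T2 distF.
case: hgamma => /finite_fsetP[D gammaD] [cover _ _].
have colour i : isometric_embeddings F (unit_sphere H) i -> exists k : D, val k i.
  rewrite -cover => -[A gA Ai].
  have AD : A \in D by move: gA; rewrite gammaD.
  by exists [` AD]%fset.
have [k0 _] : exists k : D, val k [ffun x => val x].
  by apply: colour; split=> [x|x y]; rewrite !ffunE //; apply: normF.
have /choice[col colP] T : exists k : D, linear_isometry T -> val k (emb T).
  have [/embP/colour[k kT]|nT] := pselect (linear_isometry T); first by exists k.
  by exists k0.
have eps2 : 0 < eps ^+ 2 / 4 by rewrite divr_gt0 ?exprn_gt0.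
have [T [k [[T1 T2] Tk]]] :=
  oscillation_stability hdot col hinf (fun f => (oP f).1) eps2.
pose h (y : G) := T (c (val y)).
have h1 y : `|h y| = 1.
  by apply/eqP; rewrite -(eqrXn2 (n := 2)) // expr1n T1 sqG.
have h2 x y : `|h x - h y| = `|val x - val y|.
  by apply: normr_sqr_inj; rewrite T2 distG.
pose G' : {fset H} := [fset h y | y : G]%fset.
have G'P z : z \in G' -> exists y, z = h y.
  by move=> /imfsetP[y _ ->]; exists y.
have hG' y : h y \in G' by apply/imfsetP; exists y.
exists G'; split.
- by move=> z /= /G'P[y ->]; apply: h1.
- exists [ffun y => h y].
    by split=> [y|x y]; rewrite !ffunE //=; apply: hG'.
  apply/seteqP; split=> [z [y _ <-]|z /= /G'P[y ->]]; first by rewrite ffunE /= hG'.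
  by exists y => //; rewrite ffunE.
- exists (val k); first by rewrite gammaD /=; exact: (valP k).
  move=> i [iG' idist].
  have /choice[f0 f0P] x : exists y, i x = h y by apply: G'P; apply: iG'.
  pose f : {ffun F -> G} := [ffun x => f0 x].
  have fP x : i x = h (f x) by rewrite ffunE.
  have isof : isom f by move=> x y; rewrite -h2 -!fP idist.
  have [T' [isoT' colT' nearT']] := Tk f.
  split; first by split=> // x; rewrite fP; apply: h1.
  exists (emb T'); first by rewrite -colT'; apply: colP.
  rewrite /d_sup; elim/big_ind: _ => // [x y x0 y0|x _]; first by rewrite gt_max x0.
  rewrite fP [emb T' x]ffunE /h -((oP f).2 isof x).
  rewrite -(ltr_pXn2r (n := 2)) ?nnegrE ?normr_ge0 ?(ltW heps) //.
  have := nearT' (c (val x)); rewrite sqF; have := exprn_gt0 2 heps; lra.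
Qed.
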